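(* Let $n\ge2$ and let $\{x_1,\dots,x_n\}$ be a linearly independent system of vectors in $H$. Then $$\Gamma(x_1,\dots,x_n)\le\|x_1\|^2\prod_{k=2}^n\left(\|x_k\|^2-\frac{\sum_{i=1}^{k-1}|\langle x_k,x_i\rangle|^2}{\max_{1\le i\le k-1}\|x_i\|^2+\left(\sum_{1\le i\ne j\le k-1}|\langle x_i,x_j\rangle|^2\right)^{1/2}}\right)\le\prod_{j=1}^n\|x_j\|^2.$$
   Context: $(H;\langle\cdot,\cdot\rangle)$ is an inner product space over the real or complex number field, with norm $\|x\|=\langle x,x\rangle^{1/2}$. For vectors $y_1,\dots,y_m\in H$, $\Gamma(y_1,\dots,y_m)$ denotes the Gram determinant, i.e. the determinant of the $m\times m$ matrix whose $(i,j)$-entry is $\langle y_i,y_j\rangle$. The sum over $1\le i\ne j\le k-1$ runs over all ordered pairs $(i,j)$ with $i\neq j$; an empty sum is $0$. *)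

(* Defs.v *)
From HB Require Import structures.
From mathcomp Require Import all_boot all_order all_algebra.
From mathcomp Require Import complex reals.

Set Implicit Arguments.
Unset Strict Implicit.
Unset Printing Implicit Defensive.

Import Order.TTheory GRing.Theory Num.Theory.

Local Open Scope ring_scope.

(* The library's [free] requires a finite-dimensional [vectType]; this is the
   characterisation [freeP] used as a definition over an arbitrary module. *)
Definition linearly_independent (K : nzRingType) (H : lmodType K) (n : nat)
    (x : n.-tuple H) : Prop :=
  forall c : 'I_n -> K, \sum_(i < n) c i *: x`_i = 0 -> forall i, c i = 0.

Definition gram_mx (K : nzRingType) (H : lmodType K) (dot : H -> H -> K)
    (m : nat) (y : m.-tuple H) : 'M[K]_m :=
  \matrix_(i < m, j < m) dot y`_i y`_j.

Definition gram_det (K : comNzRingType) (H : lmodType K) (dot : H -> H -> K)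
    (m : nat) (y : m.-tuple H) : K :=
  \det (gram_mx dot y).

Definition real_norm (R : realType) (H : lmodType R) (dot : H -> H -> R)
    (v : H) : R :=
  Num.sqrt (dot v v).

(* [dot v v] is a nonnegative real as an element of [R[i]]; its real part is
   that number as an element of [R]. *)
Definition complex_norm (R : realType) (H : lmodType R[i])
    (dot : H -> H -> R[i]) (v : H) : R :=
  Num.sqrt (complex.Re (dot v v)).

(* The norm of [R[i]] takes its (real) values in [R[i]]. *)
Definition cabs (R : realType) (z : R[i]) : R := complex.Re `|z|.

(* The middle term of the inequality, for [norm] the norm of [H] and
   [absdot u v] the modulus of the inner product of [u] and [v].  Vectors are
   indexed from 0, so [x`_0] is the first one.  The default value 0 of the
   maximum is harmless: the maximum is over nonnegative terms and, as [1 <= k],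
   over a nonempty range. *)
Definition gram_bound (R : realType) (H : zmodType) (norm : H -> R)
    (absdot : H -> H -> R) (n : nat) (x : n.-tuple H) : R :=
  norm x`_0 ^+ 2 *
  \prod_(1 <= k < n)
    (norm x`_k ^+ 2 -
     (\sum_(0 <= i < k) absdot x`_k x`_i ^+ 2) /
     ((\big[Num.max/0]_(0 <= i < k) norm x`_i ^+ 2) +
      Num.sqrt (\sum_(0 <= i < k) \sum_(0 <= j < k | i != j)
                  absdot x`_i x`_j ^+ 2))).

(* Main.v *)
(* Let [G_k] be the Gram determinant of the first [k] vectors.  Then
   [G_(k+1) = G_k * d^2], where [d] is the distance from [x_k] to the span of the
   previous vectors, so it suffices to bound [d^2] by the squared norm of
   [x_k - \sum_i <x_k, x_i> / M *: x_i], where [M] is the denominator of the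
   [k]-th factor.  Expanding this squared norm and bounding the quadratic term
   by the Boas-Bellman inequality [||\sum_i a_i x_i||^2 <= M * \sum_i |a_i|^2]
   gives exactly the [k]-th factor. *)
Require Import Defs.
From HB Require Import structures.
From mathcomp Require Import all_boot all_order all_algebra.
From mathcomp Require Import complex reals.

Set Implicit Arguments.
Unset Strict Implicit.
Unset Printing Implicit Defensive.

Import Order.TTheory GRing.Theory Num.Theory.

Local Open Scope ring_scope.

(** * Cauchy-Schwarz and Boas-Bellman estimates for real arrays *)

(** Lagrange's identity: the double sum of the squares [(a i * b j - a j * b i) ^+ 2] is twice the
    difference of the two sides. *)
Lemma sum_sqr_CauchySchwarz (R : realDomainType) (I : Type) (r : seq I)
    (P : pred I) (a b : I -> R) :
  (\sum_(i <- r | P i) a i * b i) ^+ 2 <=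
  (\sum_(i <- r | P i) a i ^+ 2) * (\sum_(i <- r | P i) b i ^+ 2).
Proof.
have: 0 <= \sum_(i <- r | P i) \sum_(j <- r | P j) (a i * b j - a j * b i) ^+ 2.
  by apply: sumr_ge0 => i _; apply: sumr_ge0 => j _; apply: sqr_ge0.
have -> : \sum_(i <- r | P i) \sum_(j <- r | P j) (a i * b j - a j * b i) ^+ 2 =
    ((\sum_(i <- r | P i) a i ^+ 2) * (\sum_(i <- r | P i) b i ^+ 2) -
     (\sum_(i <- r | P i) a i * b i) ^+ 2) *+ 2.
  under eq_bigr do under eq_bigr do rewrite sqrrB !exprMn.
  under eq_bigr do rewrite big_split /= sumrB.
  rewrite big_split /= sumrB.
  rewrite [X in _ + X]exchange_big /= addrAC -mulr2n mulrnBl.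
  congr (_ *+ 2 - _).
    by rewrite mulr_suml; under [RHS]eq_bigr do rewrite mulr_sumr.
  under eq_bigr do rewrite sumrMnl.
  rewrite sumrMnl expr2 mulr_suml; congr (_ *+ 2).
  apply: eq_bigr => i _; rewrite mulr_sumr; apply: eq_bigr => j _.
  by rewrite [a j * b i]mulrC mulrACA [b j * a j]mulrC.
by rewrite pmulrn_lge0 // subr_ge0.
Qed.

Lemma sum_sqrt_CauchySchwarz (R : rcfType) (I : Type) (r : seq I)
    (P : pred I) (a b : I -> R) :
  \sum_(i <- r | P i) a i * b i <=
  Num.sqrt (\sum_(i <- r | P i) a i ^+ 2) *
  Num.sqrt (\sum_(i <- r | P i) b i ^+ 2).
Proof.
rewrite -sqrtrM ?sumr_ge0 // => [|i _]; last exact: sqr_ge0.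
apply: le_trans (ler_norm _) _; rewrite -sqrtr_sqr.
by rewrite ler_wsqrtr // sum_sqr_CauchySchwarz.
Qed.

(* The Boas-Bellman estimate, for the quadratic form of an arbitrary array [g]. *)
Lemma quadratic_form_le (R : rcfType) (k : nat) (g : nat -> nat -> R)
    (a : nat -> R) :
  \sum_(0 <= i < k) \sum_(0 <= j < k) a i * a j * g i j <=
  ((\big[Num.max/0]_(0 <= i < k) g i i) +
   Num.sqrt (\sum_(0 <= i < k) \sum_(0 <= j < k | i != j) g i j ^+ 2)) *
  \sum_(0 <= i < k) a i ^+ 2.
Proof.
rewrite !big_mkord.
under eq_bigr do rewrite big_mkord.
under [X in Num.sqrt X]eq_bigr do rewrite big_mkord.
(* The diagonal terms are bounded by the maximum, the off-diagonal ones by Cauchy-Schwarz over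
   pairs. *)
under eq_bigr => i _ do rewrite (bigD1 i) //=.
rewrite big_split /= mulrDl lerD //.
  rewrite mulr_sumr ler_sum // => i _; rewrite -expr2 mulrC ler_wpM2r ?sqr_ge0 //.
  exact: (le_bigmax_cond 0 (fun i : 'I_k => g i i)).
rewrite !pair_big_dep /=.
apply: le_trans (sum_sqrt_CauchySchwarz _ _ _ _) _.
rewrite mulrC; set s := \sum_(i < k) a i ^+ 2.
have s_ge0 : 0 <= s by apply: sumr_ge0 => i _; apply: sqr_ge0.
have -> : \sum_(p : 'I_k * 'I_k | p.2 != p.1) g p.1 p.2 ^+ 2 =
    \sum_(p : 'I_k * 'I_k | p.1 != p.2 :> nat) g p.1 p.2 ^+ 2.
  by apply: eq_bigl => p; rewrite eq_sym.
(* Expanding [s ^+ 2] gives the sum of [(a i * a j) ^+ 2] over all pairs, which dominates the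
   off-diagonal part. *)
rewrite ler_wpM2l ?sqrtr_ge0 // -[leRHS](ger0_norm s_ge0) -sqrtr_sqr.
rewrite ler_wsqrtr // expr2 {2}/s mulr_sumr.
under [leRHS]eq_bigr => j _ do rewrite mulr_suml.
rewrite pair_big /= [leLHS]big_mkcond ler_sum //= => p _.
case: ifP => _; last by rewrite mulr_ge0 ?sqr_ge0.
by rewrite exprMn mulrC.
Qed.

(** * Gram determinants and distances to spans *)

Section GramBound.

(* [iota] embeds the reals in the scalars, so that [idfun] and [real_complex]
   treat the real and the complex case at once; [theta] is the conjugation. *)
Variables (R : realType) (K : numFieldType) (iota : {rmorphism R -> K}).
Variables (theta : {rmorphism K -> K}) (H : lmodType K).
Variable dot : {dot H for theta}.
Variables (norm : H -> R) (absdot : H -> H -> R).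
Hypothesis iota_le : forall a b, (iota a <= iota b) = (a <= b).
Hypothesis sqr_normE : forall z, `|z| ^+ 2 = z * theta z.
Hypothesis iota_norm : forall v, iota (norm v ^+ 2) = dot v v.
Hypothesis iota_absdot : forall u v, iota (absdot u v) = `|dot u v|.

Implicit Types (u v : H) (y : nat -> H) (a c : nat -> K).

(** Taking a sequence indexed by [nat] lets [k] vary in an induction without casts between tuple
    types. *)
Definition gram_prefix y k : 'M[K]_k := \matrix_(i, j) dot (y i) (y j).

Let theta_ge0 z : 0 <= z -> theta z = z.
Proof.
have [-> _|nz z_ge0] := eqVneq z 0; first by rewrite rmorph0.
by apply: (mulfI nz); rewrite -sqr_normE ger0_norm.
Qed.

Let norm_theta z : `|theta z| = `|z|.
Proof.
have [->|nz] := eqVneq z 0; first by rewrite rmorph0.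
have nz' : `|z| != 0 by rewrite normr_eq0.
by apply: (mulfI nz'); rewrite -normrM -sqr_normE normrX normr_id expr2.
Qed.

Let dot_ge0 v : 0 <= dot v v.
Proof.
have [->|nz] := eqVneq v 0; first by rewrite linear0l.
exact/ltW/neq0_dnorm_gt0.
Qed.

Let iota_ge0 r : (0 <= iota r) = (0 <= r).
Proof. by rewrite -(rmorph0 iota) iota_le. Qed.

Let absdot_ge0 u v : 0 <= absdot u v.
Proof. by rewrite -iota_ge0 iota_absdot. Qed.

Let absdot_diag v : absdot v v = norm v ^+ 2.
Proof.
apply/eqP; rewrite eq_le -!iota_le iota_absdot iota_norm ger0_norm ?dot_ge0 //.
by rewrite lexx.
Qed.

(* [c] are the coefficients of the orthogonal projection of [y k]. *)
Lemma gram_prefixS y k : gram_prefix y k \in unitmx ->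
  exists2 c, (forall j, (j < k)%N ->
                dot (y k - \sum_(0 <= i < k) c i *: y i) (y j) = 0) &
    \det (gram_prefix y k.+1) = \det (gram_prefix y k) *
      dot (y k - \sum_(0 <= i < k) c i *: y i)
          (y k - \sum_(0 <= i < k) c i *: y i).
Proof.
move=> uA; set A := gram_prefix y k.
pose b : 'cV[K]_k := \col_i dot (y i) (y k).
pose r : 'rV[K]_k := \row_j dot (y k) (y j).
(* The normal equations [cv *m A = r] express orthogonality of the residual to the earlier vectors;
   [c] extends [cv] by 0 beyond [k], where its values do not matter. *)
pose cv := r *m invmx A.
pose c i := if insub i is Some j then cv 0 j else 0.
have cE (j : 'I_k) : c j = cv 0 j by rewrite /c valK.
have ortho j : (j < k)%N ->
    dot (y k - \sum_(0 <= i < k) c i *: y i) (y j) = 0.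
  move=> ltjk; have /matrixP/(_ 0 (Ordinal ltjk)) : cv *m A = r by rewrite mulmxKV.
  rewrite mxE [RHS]mxE /= => rE; rewrite linearBl linear_sumlz big_mkord /= -rE.
  by apply/eqP; rewrite subr_eq0; apply/eqP/eq_bigr => i _; rewrite linearZl_LR cE [A _ _]mxE.
exists c => //; set z := y k - _.
have dot_z : dot z z = dot (y k) (y k) - \sum_(i < k) cv 0 i * b i 0.
  rewrite {2}/z linearBr /= linear_sumr big1_seq ?subr0 => [|i].
    rewrite linearBl linear_sumlz big_mkord; congr (_ - _).
    by apply: eq_bigr => i _; rewrite linearZl_LR cE [b _ _]mxE.
  by rewrite mem_index_iota => /andP[_ ltik]; rewrite linearZr_LR /= ortho ?mulr0.
pose d : 'M[K]_1 := (dot (y k) (y k))%:M.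
have -> : \det (gram_prefix y k.+1) = \det (block_mx A b r d).
  rewrite -[k.+1]addn1; congr (\det _); apply/matrixP => i j.
  rewrite mxE; case: (split_ordP i) => i' ->; case: (split_ordP j) => j' ->.
  - by rewrite block_mxEul mxE.
  - by rewrite block_mxEur mxE /= ord1 addn0.
  - by rewrite block_mxEdl mxE /= ord1 addn0.
  - by rewrite block_mxEdr mxE /= !ord1 addn0 eqxx.
(* Block elimination: the Schur complement [d - cv *m b] is the scalar [dot z z] computed in
   [dot_z]. *)
have -> : block_mx A b r d =
    block_mx 1%:M 0 cv 1%:M *m block_mx A b 0 (d - cv *m b).
  by rewrite mulmx_block !mul1mx !mul0mx !addr0 mulmxKV // addrC subrK.
rewrite det_mulmx det_lblock det_ublock !det1 !mul1r; congr (_ * _).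
by rewrite det_mx11 dot_z !mxE eqxx.
Qed.

(** Pythagoras: the competing residual is [z] plus a combination of the [y i], which is orthogonal
    to [z]. *)
Lemma dot_ortho_min y k c c' :
  (forall j, (j < k)%N -> dot (y k - \sum_(0 <= i < k) c i *: y i) (y j) = 0) ->
  dot (y k - \sum_(0 <= i < k) c i *: y i) (y k - \sum_(0 <= i < k) c i *: y i) <=
  dot (y k - \sum_(0 <= i < k) c' i *: y i) (y k - \sum_(0 <= i < k) c' i *: y i).
Proof.
set z := y k - \sum_(0 <= i < k) c i *: y i => ortho.
have -> : y k - \sum_(0 <= i < k) c' i *: y i =
    z + \sum_(0 <= i < k) (c i - c' i) *: y i.
  under [X in _ = _ + X]eq_bigr do rewrite scalerBl.
  by rewrite sumrB /z addrA subrK.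
clearbody z; rewrite hnormDd ?lerDl ?dot_ge0 // linear_sumr big1_seq // => i.
by rewrite mem_index_iota => /andP[_ ltik]; rewrite linearZr_LR /= ortho ?mulr0.
Qed.

(** After expansion and the triangle inequality, [quadratic_form_le] applies to the array of moduli
    [absdot (y i) (y j)], whose diagonal is made of squared norms. *)
Lemma dot_sum_le y k a (alpha : nat -> R) :
  (forall i, `|a i| = iota (alpha i)) ->
  dot (\sum_(0 <= i < k) a i *: y i) (\sum_(0 <= i < k) a i *: y i) <=
  iota (((\big[Num.max/0]_(0 <= i < k) norm (y i) ^+ 2) +
         Num.sqrt (\sum_(0 <= i < k) \sum_(0 <= j < k | i != j)
                     absdot (y i) (y j) ^+ 2)) *
        \sum_(0 <= i < k) alpha i ^+ 2).
Proof.
move=> aE; rewrite -[leLHS]ger0_norm ?dot_ge0 //.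
under [X in X + Num.sqrt _]eq_bigr do rewrite -absdot_diag.
have := quadratic_form_le k (fun i j => absdot (y i) (y j)) alpha.
rewrite -iota_le; apply: le_trans.
rewrite linear_sumlz rmorph_sum; apply: le_trans (ler_norm_sum _ _ _) _.
apply: ler_sum => i _; rewrite linear_sumr rmorph_sum.
apply: le_trans (ler_norm_sum _ _ _) _; apply: ler_sum => j _.
rewrite linearZl_LR linearZr_LR /= !normrM norm_theta !aE !rmorphM iota_absdot.
by rewrite mulrA.
Qed.

Definition gram_factor y k : R :=
  norm (y k) ^+ 2 -
  (\sum_(0 <= i < k) absdot (y k) (y i) ^+ 2) /
  ((\big[Num.max/0]_(0 <= i < k) norm (y i) ^+ 2) +
   Num.sqrt (\sum_(0 <= i < k) \sum_(0 <= j < k | i != j)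
               absdot (y i) (y j) ^+ 2)).

(* The vector [y k - \sum_i <y k, y i> / M *: y i], with [M] the denominator of
   [gram_factor y k], competes with the orthogonal projection. *)
Lemma gram_factor_dist y k : (0 < k)%N -> y 0 != 0 -> exists c,
  dot (y k - \sum_(0 <= i < k) c i *: y i) (y k - \sum_(0 <= i < k) c i *: y i) <=
  iota (gram_factor y k).
Proof.
move=> k_gt0 y0; rewrite /gram_factor; set M := _ + Num.sqrt _.
set S := \sum_(0 <= i < k) _.
have M_gt0 : 0 < M.
  apply: ltr_wpDr; first exact: sqrtr_ge0.
  have: 0 < norm (y 0) ^+ 2.
    by rewrite lt_def sqr_ge0 andbT -(fmorph_eq0 iota) iota_norm gt_eqF // neq0_dnorm_gt0.
  move/lt_le_trans; apply; rewrite big_mkord.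
  exact: (le_bigmax_cond 0 (fun i : 'I_k => norm (y i) ^+ 2) (j := Ordinal k_gt0)).
pose c i := dot (y k) (y i) / iota M.
pose alpha i := absdot (y k) (y i) / M.
have iM_ge0 : 0 <= (iota M)^-1 by rewrite invr_ge0 iota_ge0 ltW.
have cE i : `|c i| = iota (alpha i).
  by rewrite normrM (ger0_norm iM_ge0) -iota_absdot fmorph_div.
have alphaE : \sum_(0 <= i < k) alpha i ^+ 2 = S / M ^+ 2.
  by rewrite mulr_suml; apply: eq_bigr => i _; rewrite expr_div_n.
exists c; set w := \sum_(0 <= i < k) c i *: y i.
have dotw : dot (y k) w = iota (S / M).
  rewrite linear_sumr mulr_suml rmorph_sum; apply: eq_bigr => i _.
  rewrite linearZr_LR /= /c [theta _]rmorphM (theta_ge0 iM_ge0) mulrAC [theta _ * _]mulrC.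
  by rewrite -sqr_normE -iota_absdot -rmorphXn -fmorphV -rmorphM.
have S_ge0 : 0 <= S by apply: sumr_ge0 => i _; apply: sqr_ge0.
have -> : dot (y k - w) (y k - w) =
    dot (y k) (y k) + dot w w - (dot (y k) w + theta (dot (y k) w)).
  by rewrite hnormB mul1r.
rewrite dotw theta_ge0 ?iota_ge0 ?divr_ge0 ?(ltW M_gt0) // -iota_norm.
(* By the Boas-Bellman bound, [dot w w] is at most [M * (S / M ^+ 2)], that is [S / M]; the cross
   terms subtract [S / M] twice. *)
apply: le_trans (_ : _ <= iota (norm (y k) ^+ 2) + iota (S / M) -
  (iota (S / M) + iota (S / M))) _.
  rewrite lerD2r lerD2l.
  apply: le_trans (dot_sum_le _ _ cE) _; rewrite iota_le alphaE -/M.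
  by rewrite mulrCA expr2 invfM mulVKf ?gt_eqF.
by rewrite opprD addrA addrK rmorphB.
Qed.

(** Strict positivity is propagated because it makes the next Gram matrix invertible; it persists
    since independence keeps the residual nonzero. *)
Lemma gram_prefix_step y k : (0 < k)%N -> y 0 != 0 ->
  (forall c, y k != \sum_(0 <= i < k) c i *: y i) ->
  0 < \det (gram_prefix y k) ->
  0 < \det (gram_prefix y k.+1) <=
    \det (gram_prefix y k) * iota (gram_factor y k).
Proof.
move=> k_gt0 y0 indep det_gt0.
have [|c ortho ->] := @gram_prefixS y k.
  by rewrite unitmxE unitfE gt_eqF.
have [c' dist] := gram_factor_dist k_gt0 y0.
rewrite mulr_gt0 ?neq0_dnorm_gt0 ?subr_eq0 //=.
by rewrite ler_pM2l // (le_trans (dot_ortho_min c' ortho)).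
Qed.

Lemma gram_det_le_bound n (x : n.-tuple H) :
  (0 < n)%N -> linearly_independent x ->
  gram_det dot x <= iota (gram_bound norm absdot x) /\
  gram_bound norm absdot x <= \prod_(0 <= j < n) norm x`_j ^+ 2.
Proof.
move=> n_gt0 indep; pose y i := x`_i.
have notin k c : (k < n)%N -> y k != \sum_(0 <= i < k) c i *: y i.
  move=> ltkn; apply/eqP => yE.
  (* Coefficients [c] below [k], -1 at [k] and 0 above: a vanishing combination that contradicts
     independence at [k]. *)
  pose a (i : 'I_n) : K := if (i < k)%N then c i else - (i == k :> nat)%:R.
  have /indep/(_ (Ordinal ltkn)) : \sum_(i < n) a i *: x`_i = 0.
    rewrite -(big_mkord xpredT (fun i =>
      (if (i < k)%N then c i else - (i == k :> nat)%:R) *: y i)).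
    rewrite (big_cat_nat (n := k)) ?(ltnW ltkn) //= big_nat.
    under eq_bigr => i /andP[_ ->] do [].
    rewrite -big_nat -yE big_ltn // ltnn eqxx scaleN1r big1_seq ?addr0 ?subrr //.
    move=> i /=; rewrite mem_index_iota => /andP[ltki _].
    by rewrite ltnNge (ltnW ltki) /= gtn_eqF // oppr0 scale0r.
  by rewrite /a /= ltnn eqxx => /eqP; rewrite oppr_eq0 oner_eq0.
have y0 : y 0 != 0.
  by have := notin 0%N (fun=> 0) n_gt0; rewrite big_geq.
pose bnd k := norm x`_0 ^+ 2 * \prod_(1 <= i < k) gram_factor y i.
pose prd k := \prod_(0 <= j < k) norm x`_j ^+ 2.
suff: forall k, (k < n)%N ->
    [/\ 0 < \det (gram_prefix y k.+1), \det (gram_prefix y k.+1) <= iota (bnd k.+1)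
      & bnd k.+1 <= prd k.+1].
  move/(_ n.-1); rewrite prednK // => /(_ (leqnn n))[_ leG leB].
  by split.
elim=> [_|k IHk ltkn].
  rewrite /bnd /prd big_geq // big_nat1 mulr1 iota_norm det_mx11 mxE.
  by rewrite neq0_dnorm_gt0.
have [det_gt0 leG leB] := IHk (ltnW ltkn).
have /andP[detS_gt0 leS] := gram_prefix_step (ltn0Sn k) y0 (notin k.+1 ^~ ltkn) det_gt0.
(* The sign comes from the determinants: a positive one times this factor dominates the next, also
   positive. It allows the inequalities to be multiplied. *)
have F_ge0 : 0 <= gram_factor y k.+1.
  by rewrite -iota_ge0 -(pmulr_rge0 _ det_gt0) ltW // (lt_le_trans detS_gt0).
have bnd_ge0 : 0 <= bnd k.+1.
  by rewrite -iota_ge0 (le_trans (ltW det_gt0)).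
have bndS : bnd k.+2 = bnd k.+1 * gram_factor y k.+1.
  by rewrite /bnd big_nat_recr //= mulrA.
split=> //; rewrite bndS.
  by rewrite rmorphM (le_trans leS) // ler_wpM2r // iota_ge0.
rewrite /prd big_nat_recr //= ler_pM // lerBlDr lerDl divr_ge0 //.
  by apply: sumr_ge0 => i _; apply: sqr_ge0.
by rewrite addr_ge0 ?sqrtr_ge0 // big_mkord bigmax_ge_id.
Qed.

End GramBound.

Theorem mainTheorem7 (R : realType) :
  (forall (H : lmodType R) (dot : {dot H for idfun}) (n : nat)
          (x : n.-tuple H),
     (2 <= n)%N ->
     linearly_independent x ->
     let norm := real_norm dot in
     let bound := gram_bound norm (fun u v => `|dot u v|) x in
     gram_det dot x <= bound /\ bound <= \prod_(0 <= j < n) norm x`_j ^+ 2)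
  /\
  (forall (H : lmodType R[i]) (dot : {dot H for Num.conj}) (n : nat)
          (x : n.-tuple H),
     (2 <= n)%N ->
     linearly_independent x ->
     let norm := complex_norm dot in
     let bound := gram_bound norm (fun u v => cabs (dot u v)) x in
     gram_det dot x <= bound%:C%C /\ bound <= \prod_(0 <= j < n) norm x`_j ^+ 2).
Proof.
split=> H dot n x n_ge2 indep norm bound.
  apply: (@gram_det_le_bound R R idfun idfun) => //; last exact: ltnW.
    by move=> z; rewrite real_normK ?num_real // expr2.
  move=> v; rewrite /norm /real_norm sqr_sqrtr //.
  have [->|nz] := eqVneq v 0; first by rewrite linear0l.
  exact/ltW/neq0_dnorm_gt0.
apply: (@gram_det_le_bound R R[i] (real_complex R) Num.conj) => //.
- by move=> a b; rewrite lecR.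
- by move=> z; rewrite normCK.
(* A nonnegative element of [R[i]] is real, so [dot v v] equals its real part. *)
- move=> v; have dot_ge0 : 0 <= dot v v by exact: dnorm_ge0.
  have := dot_ge0; rewrite lecE => /andP[_ Re_ge0].
  by rewrite /norm /complex_norm sqr_sqrtr //; apply: RRe_real; exact: ger0_real.
- exact: ltnW.
Qed.
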